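(* Let $d\ge 2$ and let $A=(A_{klj})_{k,l,j=1}^d$ be a tristochastic permutation tensor, i.e. $A_{klj}\in\{0,1\}$ and $\sum_k A_{klj}=\sum_l A_{klj}=\sum_j A_{klj}=1$ for all values of the remaining indices. For each $k\in\{1,\dots,d\}$ let $\{|a_{k,l}\rangle\}_{l=1}^d$ be an orthonormal basis of $\mathbb{C}^d$. Define the operator $U$ on $\mathbb{C}^d\otimes\mathbb{C}^d$ by its matrix elements $\langle k,i|U|l,j\rangle = U_{ki,lj}=A_{klj}\,(a_{k,l})_i$, where $(a_{k,l})_i=\langle i|a_{k,l}\rangle$ (this $U$ is unitary), and the channel $\Phi_A(\rho_1\otimes\rho_2)=\mathrm{Tr}_2[U(\rho_1\otimes\rho_2)U^\dagger]$. Then $U$ has maximal entangling power, $e_p(U)=1$, if and only if $\Phi_A$ is a quantum tristochastic channel.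
   Context: Entangling power: for a unitary $U$ on $\mathbb{C}^d\otimes\mathbb{C}^d$, $e_p(U)=\frac{d+1}{d-1}\,\mathbb{E}_{|\psi_A\rangle,|\psi_B\rangle}\big[\mathcal{E}(U(|\psi_A\rangle\otimes|\psi_B\rangle))\big]$, where the average is over independent Haar-random pure states on each factor and $\mathcal{E}(|\psi\rangle)=1-\mathrm{Tr}\rho_A^2$ with $\rho_A=\mathrm{Tr}_B|\psi\rangle\langle\psi|$ is the linear entropy of entanglement; $e_p\in[0,1]$. Dynamical matrix of $\Phi_A$: the operator $D$ on $\mathbb{C}^d\otimes\mathbb{C}^d\otimes\mathbb{C}^d$ with $\langle k,l,j|D|k',l',j'\rangle=\sum_i U_{ki,lj}\overline{U_{k'i,l'j'}}$, so that $\Phi_A(\rho_2\otimes\rho_3)=\mathrm{Tr}_{2,3}[D(\mathbb{I}\otimes\rho_2^\top\otimes\rho_3^\top)]$. The channel is called quantum tristochastic if, in addition, the maps $\rho_1\otimes\rho_2\mapsto \mathrm{Tr}_{1,3}[D(\rho_1^\top\otimes\mathbb{I}\otimes\rho_2^\top)]$ and $\rho_1\otimes\rho_2\mapsto\mathrm{Tr}_{1,2}[D(\rho_1^\top\otimes\rho_2^\top\otimes\mathbb{I})]$ (for density matrices $\rho_1,\rho_2$ on $\mathbb{C}^d$) are also valid quantum channels (completely positive and trace preserving). *)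

(* Defs.v *)
From HB Require Import structures.
From mathcomp Require Import all_boot all_order all_algebra.
From mathcomp Require Import complex.
From mathcomp Require Import all_classical all_reals all_analysis.
Import Order.TTheory GRing.Theory Num.Theory.

Set Implicit Arguments.
Unset Strict Implicit.
Unset Printing Implicit Defensive.

Local Open Scope classical_set_scope.
Local Open Scope ring_scope.

(* Vectors of C^d are column vectors 'cV[R[i]]_d; operators on a finite-       *)
(* dimensional space with basis indexed by a finType I are functions        *)
(* I -> I -> R[i] (matrix elements <p|M|q> = M p q).                        *)

Definition cvec (R : realType) (d : nat) : Type := 'cV[R[i]]_d.
HB.instance Definition _ (R : realType) (d : nat) :=
  Choice.on (cvec R d).
HB.instance Definition _ (R : realType) (d : nat) :=
  isPointed.Build (cvec R d) 0.

Section Defs.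
Variable R : realType.
Local Notation C := R[i].

Definition dotc (d : nat) (u v : 'cV[C]_d) : C := \sum_i (u i 0)^* * v i 0.

Definition orthonormal_basis (d : nat) (b : 'I_d -> 'cV[C]_d) : Prop :=
  forall l l' : 'I_d, dotc (b l) (b l') = (l == l')%:R.

Definition unitary_mx (d : nat) (V : 'M[C]_d) : Prop :=
  forall a b : 'I_d, \sum_i (V i a)^* * V i b = (a == b)%:R.

Definition tristochastic_perm_tensor (d : nat)
    (A : 'I_d -> 'I_d -> 'I_d -> nat) : Prop :=
  [/\ (forall k l j, A k l j <= 1)%N,
      (forall l j, \sum_k A k l j = 1)%N,
      (forall k j, \sum_l A k l j = 1)%N &
      (forall k l, \sum_j A k l j = 1)%N].

(* U_{ki,lj} = A_{klj} (a_{k,l})_i ; U k i l j = <k,i|U|l,j> *)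
Definition U_of (d : nat) (A : 'I_d -> 'I_d -> 'I_d -> nat)
    (a : 'I_d -> 'I_d -> 'cV[C]_d) : 'I_d -> 'I_d -> 'I_d -> 'I_d -> C :=
  fun k i l j => (A k l j)%:R * a k l i 0.

Definition apply_U_prod (d : nat) (U : 'I_d -> 'I_d -> 'I_d -> 'I_d -> C)
    (x y : 'cV[C]_d) : 'I_d -> 'I_d -> C :=
  fun k i => \sum_l \sum_j U k i l j * (x l 0 * y j 0).

Definition red_dens (d : nat) (phi : 'I_d -> 'I_d -> C) : 'I_d -> 'I_d -> C :=
  fun k k' => \sum_i phi k i * (phi k' i)^*.

(* linear entropy 1 - Tr rho_A^2 (a real number; we take its real part) *)
Definition linear_entropy (d : nat) (phi : 'I_d -> 'I_d -> C) : R :=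
  complex.Re (1 - \sum_k \sum_k' red_dens phi k k' * red_dens phi k' k).

(* Measurable structure on C^d: the sigma-algebra generated by the real and
   imaginary parts of the coordinates (i.e. the Borel sigma-algebra of
   C^d ~ R^(2d)). *)
Definition coord_sets (d : nat) : set (set (cvec R d)) :=
  [set S | exists (i : 'I_d) (B : set R), measurable B /\
     (S = (fun v : 'cV[C]_d => complex.Re (v i 0)) @^-1` B \/
      S = (fun v : 'cV[C]_d => complex.Im (v i 0)) @^-1` B)].

Definition state_space (d : nat) := g_sigma_algebraType (@coord_sets d).

Definition haar_pure_state_measure (d : nat)
    (P : probability (state_space d) R) : Prop :=
  P [set x : state_space d | dotc (x : 'cV[C]_d) x = 1] = 1%E /\
  forall V : 'M[C]_d, unitary_mx V ->
    forall S : set (state_space d), measurable S ->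
      P ((fun x : state_space d => (V *m (x : 'cV[C]_d) : state_space d))
           @^-1` S) = P S.

(* e_p(U) = (d+1)/(d-1) E_{psi_A,psi_B} [ E(U |psi_A> (x) |psi_B>) ],
   psi_A, psi_B independent Haar-random pure states. *)
Definition entangling_power (d : nat) (P : probability (state_space d) R)
    (U : 'I_d -> 'I_d -> 'I_d -> 'I_d -> C) : R :=
  (d%:R + 1) / (d%:R - 1) *
  Rintegral P setT (fun x : state_space d =>
    Rintegral P setT (fun y : state_space d =>
      linear_entropy (apply_U_prod U (x : 'cV[C]_d) (y : 'cV[C]_d)))).

Definition psd (I : finType) (M : I -> I -> C) : Prop :=
  forall v : I -> C, 0 <= \sum_p \sum_q (v p)^* * M p q * v q.

(* A linear map Phi : L(C^I) -> L(C^J) given by its kernel: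
   Phi(X) j j' = \sum_{i,i'} K j j' i i' X i i'. *)
Definition apply_kernel (I J : finType) (K : J -> J -> I -> I -> C)
  (X : I -> I -> C) : J -> J -> C :=
  fun j j' => \sum_i \sum_i' K j j' i i' * X i i'.

Definition completely_positive (I J : finType) (K : J -> J -> I -> I -> C) :
  Prop :=
  forall (n : nat) (X : ('I_n * I)%type -> ('I_n * I)%type -> C), psd X ->
    psd (fun p q : ('I_n * J)%type =>
           \sum_i \sum_i' K p.2 q.2 i i' * X (p.1, i) (q.1, i')).

Definition trace_preserving (I J : finType) (K : J -> J -> I -> I -> C) :
  Prop :=
  forall X : I -> I -> C, \sum_j apply_kernel K X j j = \sum_i X i i.

Definition quantum_channel (I J : finType) (K : J -> J -> I -> I -> C) :
  Prop := completely_positive K /\ trace_preserving K.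

(* dynamical matrix D: <k,l,j|D|k',l',j'> = \sum_i U_{ki,lj} conj U_{k'i,l'j'} *)
Definition dyn_mx (d : nat) (U : 'I_d -> 'I_d -> 'I_d -> 'I_d -> C)
  (k l j k' l' j' : 'I_d) : C :=
  \sum_i U k i l j * (U k' i l' j')^*.

(* Phi_A(rho2 (x) rho3) = Tr_{2,3}[D (I (x) rho2^T (x) rho3^T)], extended
   linearly to L(C^d (x) C^d): kernel (k,k') <- ((l,j),(l',j')) *)
Definition chan1_kernel (d : nat) (U : 'I_d -> 'I_d -> 'I_d -> 'I_d -> C) :
  'I_d -> 'I_d -> ('I_d * 'I_d)%type -> ('I_d * 'I_d)%type -> C :=
  fun k k' p q => dyn_mx U k p.1 p.2 k' q.1 q.2.

(* rho1 (x) rho2 |-> Tr_{1,3}[D (rho1^T (x) I (x) rho2^T)] *)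
Definition chan2_kernel (d : nat) (U : 'I_d -> 'I_d -> 'I_d -> 'I_d -> C) :
  'I_d -> 'I_d -> ('I_d * 'I_d)%type -> ('I_d * 'I_d)%type -> C :=
  fun l l' p q => dyn_mx U p.1 l p.2 q.1 l' q.2.

(* rho1 (x) rho2 |-> Tr_{1,2}[D (rho1^T (x) rho2^T (x) I)] *)
Definition chan3_kernel (d : nat) (U : 'I_d -> 'I_d -> 'I_d -> 'I_d -> C) :
  'I_d -> 'I_d -> ('I_d * 'I_d)%type -> ('I_d * 'I_d)%type -> C :=
  fun j j' p q => dyn_mx U p.1 p.2 j q.1 q.2 j'.

Definition quantum_tristochastic (d : nat)
    (U : 'I_d -> 'I_d -> 'I_d -> 'I_d -> C) : Prop :=
  [/\ quantum_channel (chan1_kernel U),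
      quantum_channel (chan2_kernel U) &
      quantum_channel (chan3_kernel U)].

End Defs.

(* Main.v *)
Require Import Defs.
From HB Require Import structures.
From mathcomp Require Import all_boot all_order all_algebra.
From mathcomp Require Import complex.
From mathcomp Require Import all_classical all_reals all_analysis.
From mathcomp Require Import measurable_realfun.
From mathcomp Require Import ring lra.
Import Order.TTheory GRing.Theory Num.Theory.
Local Open Scope ring_scope.

Set Implicit Arguments.
Unset Strict Implicit.
Unset Printing Implicit Defensive.

(* Invariance of the Haar state under the phase i on one coordinate and under
   plane rotations forces
     E[x_l x_m conj(x_l') conj(x_m')] =
       (delta_ll' delta_mm' + delta_lm' delta_ml') / (d (d + 1)).
   Write A_klj = [j = pi_k(l)] with pi a Latin square.  Then the mean purity of
   U (x (x) y) is
     (2 d^2 (d + 1) + Q) / (d (d + 1))^2,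
   where Q >= 0 is the sum over k <> k' of the squared overlaps
   |<a_k'l'|a_kl>|^2 with l = l', plus those with pi_k(l) = pi_k'(l').  So
   e_p(U) = 1 iff Q = 0.  The three maps are always completely positive (Kraus
   form) and the first is trace preserving; the second (third) is trace
   preserving iff the first (second) family of overlaps vanishes. *)

(** * Real and imaginary parts of complex numbers *)

Section ComplexParts.
Variable R : realType.
Implicit Types x y : R[i].

Lemma complexReD x y : complex.Re (x + y) = complex.Re x + complex.Re y.
Proof. by case: x y => [? ?] []. Qed.

Lemma complexImD x y : complex.Im (x + y) = complex.Im x + complex.Im y.
Proof. by case: x y => [? ?] []. Qed.

Lemma complexReM x y :
  complex.Re (x * y) =
  complex.Re x * complex.Re y - complex.Im x * complex.Im y.
Proof. by case: x y => [? ?] []. Qed.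

Lemma complexImM x y :
  complex.Im (x * y) =
  complex.Re x * complex.Im y + complex.Im x * complex.Re y.
Proof. by case: x y => [? ?] []. Qed.

Lemma complexReJ x : complex.Re (x^*) = complex.Re x.
Proof. by case: x. Qed.

Lemma complexImJ x : complex.Im (x^*) = - complex.Im x.
Proof. by case: x. Qed.

Lemma complex_ext x y :
  complex.Re x = complex.Re y -> complex.Im x = complex.Im y -> x = y.
Proof. by case: x y => [? ?] [? ?] /= -> ->. Qed.

Lemma ler_Re_norm x (M : R[i]) : `|x| <= M -> `|complex.Re x| <= complex.Re M.
Proof.
by move/(le_trans (normc_ge_Re x)); rewrite lecE /= => /andP[_].
Qed.

Lemma ler_Im_norm x (M : R[i]) : `|x| <= M -> `|complex.Im x| <= complex.Re M.
Proof.
(* Since the real part of [x * 'i] is minus the imaginary part of [x], and ['i] has norm 1, the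
   bound for real parts applies. *)
move=> xM; rewrite -normrN -ReiNIm; apply: ler_Re_norm.
by rewrite normrM normCi mulr1.
Qed.

End ComplexParts.

(** * Unitary maps and the expectation of complex functions on the state space *)

Lemma dotc_mulmx (R : realType) (d : nat) (V : 'M[R[i]]_d) (x : 'cV[R[i]]_d) :
  unitary_mx V -> dotc (V *m x) (V *m x) = dotc x x.
Proof.
move=> uV; rewrite /dotc.
under eq_bigr do rewrite !mxE rmorph_sum /= mulr_suml.
rewrite exchange_big /=; apply: eq_bigr => a _.
under eq_bigr do rewrite mulr_sumr.
rewrite exchange_big /= (bigD1 a) //= [X in _ + X]big1 => [|b ba].
  rewrite addr0.
  transitivity (\sum_i (x a 0)^* * x a 0 * ((V i a)^* * V i a)).
    by apply: eq_bigr => i _; rewrite rmorphM /=; ring.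
  by rewrite -mulr_sumr uV eqxx mulr1.
transitivity (\sum_i (x a 0)^* * x b 0 * ((V i a)^* * V i b)).
  by apply: eq_bigr => i _; rewrite rmorphM /=; ring.
by rewrite -mulr_sumr uV eq_sym (negPf ba) mulr0.
Qed.

Section ComplexExpectation.
Variables (R : realType) (d : nat).
Local Notation C := R[i].
Local Notation T := (state_space R d).
Local Open Scope classical_set_scope.
Implicit Types f g : T -> C.

Definition unit_sphere : set T := [set x | dotc (x : 'cV[C]_d) x = 1].

Definition cmeasurable f :=
  measurable_fun setT (fun x => complex.Re (f x)) /\
  measurable_fun setT (fun x => complex.Im (f x)).

Lemma cmeasurable_coord (i : 'I_d) : cmeasurable (fun x : T => (x : 'cV[C]_d) i 0).
Proof.
split=> _ B mB; rewrite setTI; apply: sub_sigma_algebra;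
  exists i, B; split=> //; by [left | right].
Qed.

Lemma cmeasurable_cst (c : C) : cmeasurable (fun=> c).
Proof. by split; exact: measurable_cst. Qed.

Lemma cmeasurableJ f : cmeasurable f -> cmeasurable (fun x => (f x)^*).
Proof.
move=> [mr mi]; split.
  by under eq_fun do rewrite complexReJ.
under eq_fun do rewrite complexImJ.
exact: (measurableT_comp (@oppr_measurable R setT) mi).
Qed.

Lemma cmeasurableD f g :
  cmeasurable f -> cmeasurable g -> cmeasurable (fun x => f x + g x).
Proof.
move=> [fr fi] [gr gi]; split.
  by under eq_fun do rewrite complexReD; exact: measurable_funD.
by under eq_fun do rewrite complexImD; exact: measurable_funD.
Qed.

Lemma cmeasurableM f g :
  cmeasurable f -> cmeasurable g -> cmeasurable (fun x => f x * g x).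
Proof.
move=> [fr fi] [gr gi]; split.
  under eq_fun do rewrite complexReM.
  by apply: measurable_funB; exact: measurable_funM.
under eq_fun do rewrite complexImM.
by apply: measurable_funD; exact: measurable_funM.
Qed.

Lemma cmeasurable_sum (I : Type) (r : seq I) (F : I -> T -> C) :
  (forall i, cmeasurable (F i)) -> cmeasurable (fun x => \sum_(i <- r) F i x).
Proof.
move=> mF; elim: r => [|i r IH].
  by under eq_fun do rewrite big_nil; exact: cmeasurable_cst.
by under eq_fun do rewrite big_cons; exact: cmeasurableD.
Qed.

Lemma cmeasurable_eq_cst f c : cmeasurable f -> measurable [set x | f x = c].
Proof.
move=> [fr fi].
have -> : [set x | f x = c] =
    (fun x => complex.Re (f x)) @^-1` [set complex.Re c] `&`
    (fun x => complex.Im (f x)) @^-1` [set complex.Im c].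
  apply/seteqP; split=> x /= => [->|[]] //; exact: complex_ext.
by apply: measurableI; rewrite -[X in measurable X]setTI; [apply: fr|apply: fi].
Qed.

Lemma measurable_unit_sphere : measurable unit_sphere.
Proof.
apply: cmeasurable_eq_cst; apply: cmeasurable_sum => i.
by apply: cmeasurableM; [apply: cmeasurableJ|]; exact: cmeasurable_coord.
Qed.

(** The bound is asked only on the unit sphere, which carries all the mass of a Haar state:
    monomials in the coordinates are unbounded on [C^d], yet belong to this class and are
    integrable. *)
Definition sphere_bounded f :=
  cmeasurable f /\ exists M : C, forall x, unit_sphere x -> `|f x| <= M.

Lemma sphere_bounded_cst (c : C) : sphere_bounded (fun=> c).
Proof. by split; [exact: cmeasurable_cst|exists `|c|]. Qed.

Lemma sphere_bounded_coord (i : 'I_d) :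
  sphere_bounded (fun x : T => (x : 'cV[C]_d) i 0).
Proof.
split; first exact: cmeasurable_coord.
exists 1 => x; rewrite /unit_sphere /dotc /= => x1.
(* The squared modulus of one coordinate is a single term of the nonnegative sum [dotc x x = 1]. *)
rewrite -(@expr_le1 _ 2) // -x1 (bigD1 i) //= -normCKC lerDl.
by apply: sumr_ge0 => j _; rewrite -normCKC exprn_ge0.
Qed.

Lemma sphere_boundedJ f : sphere_bounded f -> sphere_bounded (fun x => (f x)^*).
Proof.
move=> [mf [M fM]]; split; first exact: cmeasurableJ.
by exists M => x sx; rewrite norm_conjC; exact: fM.
Qed.

Lemma sphere_boundedD f g :
  sphere_bounded f -> sphere_bounded g -> sphere_bounded (fun x => f x + g x).
Proof.
move=> [mf [M fM]] [mg [N gN]]; split; first exact: cmeasurableD.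
exists (M + N) => x sx; apply: le_trans (ler_normD _ _) _.
by apply: lerD; [exact: fM|exact: gN].
Qed.

Lemma sphere_boundedM f g :
  sphere_bounded f -> sphere_bounded g -> sphere_bounded (fun x => f x * g x).
Proof.
move=> [mf [M fM]] [mg [N gN]]; split; first exact: cmeasurableM.
exists (M * N) => x sx; rewrite normrM.
by apply: ler_pM => //; [exact: fM|exact: gN].
Qed.

Lemma sphere_bounded_sum (I : Type) (r : seq I) (F : I -> T -> C) :
  (forall i, sphere_bounded (F i)) ->
  sphere_bounded (fun x => \sum_(i <- r) F i x).
Proof.
move=> mF; elim: r => [|i r IH].
  by under eq_fun do rewrite big_nil; exact: sphere_bounded_cst.
by under eq_fun do rewrite big_cons; exact: sphere_boundedD.
Qed.

(** Preimages of the generators suffice, and every coordinate of [V *m x] is a linear combination of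
    the coordinates of [x]. *)
Lemma measurable_mulmx (V : 'M[C]_d) :
  measurable_fun setT (fun x : T => (V *m (x : 'cV[C]_d) : T)).
Proof.
have mV i : cmeasurable (fun x : T => (V *m (x : 'cV[C]_d)) i 0).
  under eq_fun do rewrite mxE.
  apply: cmeasurable_sum => j; apply: cmeasurableM; first exact: cmeasurable_cst.
  exact: cmeasurable_coord.
apply: (@measurability _ _ T T setT _ (@coord_sets R d)) => //.
move=> _ [_ [i [B [mB [->|->]]]] <-]; have [mr mi] := mV i.
  exact: mr.
exact: mi.
Qed.

Variable P : probability T R.

Definition cexpect f : C :=
  (Rintegral P setT (fun x => complex.Re (f x)) +i*
   Rintegral P setT (fun x => complex.Im (f x)))%C.

Lemma cexpect_cst c : cexpect (fun=> c) = c.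
Proof.
rewrite /cexpect !Rintegral_cst //= probability_setT /= !mulr1.
by case: c.
Qed.

Hypothesis P_haar : haar_pure_state_measure P.

Lemma probability_sphereC : P (~` unit_sphere) = 0%E.
Proof.
rewrite probability_setC; last exact: measurable_unit_sphere.
by case: P_haar => -> _; rewrite subee.
Qed.

(** The complement of the sphere is null, so the integral of the absolute value reduces to the
    sphere, where a bounded function has a finite integral. *)
Lemma integrable_sphere_bounded (h : T -> R) (M : R) :
  measurable_fun setT h -> (forall x, unit_sphere x -> `|h x| <= M) ->
  P.-integrable setT (EFin \o h).
Proof.
move=> mh hM; have mS := measurable_unit_sphere.
apply/integrableP; split; first exact/measurable_EFinP.
have -> : (\int[P]_x `|(EFin \o h) x| = \int[P]_(x in unit_sphere) `|(EFin \o h) x|)%E.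
  rewrite (@ge0_negligible_integral _ _ _ _ _ (~` unit_sphere)) //.
  - by rewrite setTD setCK.
  - exact: measurableC.
  - by apply: measurableT_comp => //; exact/measurable_EFinP.
  - exact: probability_sphereC.
have /integrableP[//] : P.-integrable unit_sphere (EFin \o h).
apply: measurable_bounded_integrable => //.
- by apply: le_lt_trans (probability_le1 _ mS) _; rewrite ltry.
- exact: measurable_funTS.
- by exists M; split; [exact: num_real|] => x Mx y Sy /=; apply: le_trans (hM _ Sy) (ltW Mx).
Qed.

Lemma sphere_bounded_integrable f : sphere_bounded f ->
  P.-integrable setT (EFin \o (fun x => complex.Re (f x))) /\
  P.-integrable setT (EFin \o (fun x => complex.Im (f x))).
Proof.
move=> [[mr mi] [M fM]].
split; apply: (@integrable_sphere_bounded _ (complex.Re M)) => // x sx.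
  exact/ler_Re_norm/fM.
exact/ler_Im_norm/fM.
Qed.

Lemma cexpectD f g : sphere_bounded f -> sphere_bounded g ->
  cexpect (fun x => f x + g x) = cexpect f + cexpect g.
Proof.
move=> /sphere_bounded_integrable[fr fi] /sphere_bounded_integrable[gr gi].
rewrite /cexpect.
under eq_Rintegral do rewrite complexReD.
under [X in (_ +i* X)%C = _]eq_Rintegral do rewrite complexImD.
by rewrite !RintegralD.
Qed.

Lemma cexpectZ c f : sphere_bounded f ->
  cexpect (fun x => c * f x) = c * cexpect f.
Proof.
move=> /sphere_bounded_integrable[fr fi].
have int_scale (r : R) (h : T -> R) : P.-integrable setT (EFin \o h) ->
    P.-integrable setT (EFin \o (fun x => r * h x)).
  by move=> ih; exact: (integrableZl _ r ih).
rewrite /cexpect.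
under eq_Rintegral do rewrite complexReM.
under [X in (_ +i* X)%C = _]eq_Rintegral do rewrite complexImM.
rewrite RintegralB ?RintegralD ?RintegralZl //; try exact: int_scale.
by case: c.
Qed.

Lemma cexpect_sum (I : Type) (r : seq I) (F : I -> T -> C) :
  (forall i, sphere_bounded (F i)) ->
  cexpect (fun x => \sum_(i <- r) F i x) = \sum_(i <- r) cexpect (F i).
Proof.
move=> bF; elim: r => [|i r IH].
  rewrite big_nil -[RHS](cexpect_cst 0); congr cexpect; apply/funext => x.
  by rewrite big_nil.
rewrite big_cons -IH -cexpectD //; last exact: sphere_bounded_sum.
by congr cexpect; apply/funext => x; rewrite big_cons.
Qed.

Lemma eq_cexpect_sphere f c : cmeasurable f ->
  (forall x, unit_sphere x -> f x = c) -> cexpect f = c.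
Proof.
move=> [mr mi] fc; rewrite -[RHS]cexpect_cst.
have ae_eq_sphere (h : T -> R) (r : R) : measurable_fun setT h ->
    (forall x, unit_sphere x -> h x = r) ->
    Rintegral P setT h = Rintegral P setT (fun=> r).
  move=> mh hr; rewrite /Rintegral; congr fine.
  apply: ae_eq_integral => //; [exact/measurable_EFinP|].
  exists (~` unit_sphere); split.
  - by apply: measurableC; exact: measurable_unit_sphere.
  - exact: probability_sphereC.
  - by move=> x /=; apply: contra_not => /hr -> _.
by rewrite /cexpect; congr (_ +i* _)%C; apply: ae_eq_sphere => // x /fc ->.
Qed.

Lemma unit_sphere_mulmx (V : 'M[C]_d) (x : T) :
  unitary_mx V -> unit_sphere x -> unit_sphere (V *m (x : 'cV[C]_d) : T).
Proof. by move=> uV; rewrite /unit_sphere /= dotc_mulmx. Qed.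

(** Change of variables: the integral becomes one against the pushforward of [P] under [V], which
    agrees with [P] on measurable sets. Boundedness survives because [V] maps the sphere into
    itself. *)
Lemma cexpect_mulmx f (V : 'M[C]_d) : sphere_bounded f -> unitary_mx V ->
  cexpect (fun x : T => f (V *m (x : 'cV[C]_d))) = cexpect f.
Proof.
move=> [[mr mi] [M fM]] uV.
have mV := measurable_mulmx V.
have P_inv (h : T -> R) : measurable_fun setT h ->
    (forall x, unit_sphere x -> `|h x| <= complex.Re M) ->
    Rintegral P setT (fun x : T => h (V *m (x : 'cV[C]_d))) = Rintegral P setT h.
  move=> mh hM; rewrite /Rintegral; congr fine.
  rewrite -(@integral_pushforward _ _ _ _ _ _ mV P setT (EFin \o h)) //.
  - apply: eq_measure_integral => S mS _.
    by case: P_haar => _ /(_ V uV S mS).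
  - exact/measurable_EFinP.
  - rewrite preimage_setT.
    apply: (@integrable_sphere_bounded (fun x : T => h (V *m (x : 'cV[C]_d))) (complex.Re M)).
      exact: (measurableT_comp mh mV).
    by move=> x sx; apply: hM; exact: unit_sphere_mulmx.
rewrite /cexpect; congr (_ +i* _)%C.
  by apply: (P_inv (fun x => complex.Re (f x))) => // x /fM; exact: ler_Re_norm.
by apply: (P_inv (fun x => complex.Im (f x))) => // x /fM; exact: ler_Im_norm.
Qed.

End ComplexExpectation.

(** * Fourth moments of a Haar-random pure state *)

Section HaarMoments.
Variables (R : realType) (d : nat).
Local Notation C := R[i].
Local Notation T := (state_space R d).
Implicit Types (x : T) (l m p q : 'I_d).

Definition monom4 l m l' m' x : C :=
  (x : 'cV[C]_d) l 0 * (x : 'cV[C]_d) m 0 *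
  ((x : 'cV[C]_d) l' 0)^* * ((x : 'cV[C]_d) m' 0)^*.

Lemma sphere_bounded_monom4 l m l' m' : sphere_bounded (monom4 l m l' m').
Proof.
by do !apply: sphere_boundedM; try apply: sphere_boundedJ;
  exact: sphere_bounded_coord.
Qed.

Lemma unitary_diag_mx (u : 'rV[C]_d) :
  (forall i, (u 0 i)^* * u 0 i = 1) -> unitary_mx (diag_mx u).
Proof.
move=> u1 a b; rewrite (bigD1 a) //= big1 => [|i ia].
  rewrite !mxE eqxx mulr1n addr0.
  by case: eqP => _; rewrite ?mulr1n ?u1 // mulr0n mulr0.
by rewrite !mxE (negPf ia) mulr0n rmorph0 mul0r.
Qed.

(** A rotation of the plane of coordinates [p] and [q]. The parameters are complex numbers; that
    they are real is imposed later by [c^* = c] and [s^* = s]. *)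
Definition rotation_mx p q (c s : C) : 'M[C]_d := \matrix_(i, j)
  if i == p then c * (j == p)%:R + s * (j == q)%:R
  else if i == q then - s * (j == p)%:R + c * (j == q)%:R
  else (i == j)%:R.

Lemma unitary_rotation_mx p q c s : p != q -> c^* = c -> s^* = s ->
  c ^+ 2 + s ^+ 2 = 1 -> unitary_mx (rotation_mx p q c s).
Proof.
move=> pq cJ sJ cs a b; have qp : q != p by rewrite eq_sym.
rewrite (bigD1 p) //= (bigD1 q) //= !mxE !eqxx (negPf qp).
(* Rows other than [p] and [q] are those of the identity, so they contribute a delta supported away
   from these two columns. *)
have -> : \sum_(i < d | (i != p) && (i != q))
    (rotation_mx p q c s i a)^* * rotation_mx p q c s i b =
    ((a == b) && ((a != p) && (a != q)))%:R.
  transitivity (\sum_(i < d | (i != p) && (i != q)) ((i == a) && (i == b))%:R : C).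
    apply: eq_bigr => i /andP[/negPf ip /negPf iq].
    by rewrite !mxE ip iq conjC_nat -natrM mulnb.
  have [apq|] := boolP ((a != p) && (a != q)).
    rewrite (bigD1 a) //= eqxx big1 ?addr0; first by rewrite andbT.
    by move=> i /andP[_ /negPf ->].
  move=> /negPf apq; rewrite andbF big1 // => i.
  by have [->|//] := eqVneq i a; rewrite apq.
rewrite !(rmorphD, rmorphM, rmorphN) /= !conjC_nat cJ sJ.
have [->|ap] := eqVneq a p.
  rewrite (negPf pq); have [->|bp] := eqVneq b p.
    by rewrite ?(negPf pq) /= -[RHS]cs; ring.
  have [_|bq] := eqVneq b q; rewrite /=; first by ring.
  by rewrite /=; ring.
have [->|aq] := eqVneq a q.
  have [->|bp] := eqVneq b p.
    by rewrite ?(negPf pq) ?(negPf qp) /=; ring.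
  have [_|bq] := eqVneq b q; rewrite /=; first by rewrite -[RHS]cs; ring.
  by rewrite /=; ring.
by rewrite /= !andbT; ring.
Qed.

Lemma rotation_mxE p q c s (x : 'cV[C]_d) : p != q ->
  (rotation_mx p q c s *m x) p 0 = c * x p 0 + s * x q 0.
Proof.
move=> pq; have qp : q != p by rewrite eq_sym.
rewrite mxE (bigD1 p) //= (bigD1 q) //= big1 => [|i /andP[ip iq]].
  by rewrite !mxE !eqxx (negPf pq) (negPf qp) /=; ring.
by rewrite !mxE eqxx (negPf ip) (negPf iq) /=; ring.
Qed.

Variable P : probability T R.
Hypothesis P_haar : haar_pure_state_measure P.

Definition moment4 l m l' m' : C := cexpect P (monom4 l m l' m').

(** Invariance under a diagonal unitary: every coordinate picks up its own phase, so a total phase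
    other than 1 forces the moment to vanish. *)
Lemma moment4_phase (u : 'rV[C]_d) l m l' m' :
  (forall i, (u 0 i)^* * u 0 i = 1) ->
  moment4 l m l' m' =
  u 0 l * u 0 m * (u 0 l')^* * (u 0 m')^* * moment4 l m l' m'.
Proof.
move=> u1; rewrite /moment4 -(cexpectZ P_haar); last exact: sphere_bounded_monom4.
rewrite -[LHS](@cexpect_mulmx _ _ _ P_haar _ (diag_mx u)).
- congr cexpect; apply/funext => x.
  by rewrite /monom4 !mul_diag_mx !mxE !rmorphM /=; ring.
- exact: sphere_bounded_monom4.
- exact: unitary_diag_mx.
Qed.

(* The phase [i] on the single coordinate [c] multiplies the monomial by a
   power of [i] whose exponent is the difference of the two counts, which lies
   between -2 and 2. *)
Lemma moment4_eq0 c l m l' m' :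
  ((l == c) + (m == c) != (l' == c) + (m' == c))%N -> moment4 l m l' m' = 0.
Proof.
pose u : 'rV[C]_d := \row_j if j == c then 'i else 1.
have uE i : u 0 i = if i == c then 'i else 1 by rewrite mxE.
have ii : 'i * 'i = -1 :> C by rewrite -expr2 sqrCi.
have u1 i : (u 0 i)^* * u 0 i = 1.
  by rewrite uE; case: eqP => _; rewrite ?rmorph1 ?mulr1 // conjCi mulNr ii opprK.
have := moment4_phase l m l' m' u1; rewrite !uE; move: (moment4 _ _ _ _) => M.
have M0 : M = - M -> M = 0.
  by move=> /eqP; rewrite -addr_eq0 -mulr2n mulrn_eq0 /= => /eqP.
(* For a total phase ['i] or its opposite, applying the identity twice gives the sign -1 and reduces
   to [M0]. *)
have Mi (w : C) : w * w = -1 -> M = w * M -> M = 0.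
  by move=> ww E; apply: M0; rewrite -[RHS]mulN1r -ww -mulrA -!E.
by case: (l == c); case: (m == c); case: (l' == c); case: (m' == c) => //= E _;
  rewrite ?conjCi ?rmorph1 in E;
  first [by apply: M0; rewrite {1}E; ring: ii | by apply: (Mi _ _ E); ring: ii].
Qed.

Lemma moment4_rotation p q c s : p != q -> c^* = c -> s^* = s ->
  c ^+ 2 + s ^+ 2 = 1 ->
  moment4 p p p p = c ^+ 4 * moment4 p p p p + s ^+ 4 * moment4 q q q q +
    4 * c ^+ 2 * s ^+ 2 * moment4 p q p q.
Proof.
move=> pq cJ sJ cs; have qp : q != p by rewrite eq_sym.
have bM := sphere_bounded_monom4.
have bZ k l m l' m' : sphere_bounded (fun x => k * monom4 l m l' m' x).
  by apply: sphere_boundedM => //; exact: sphere_bounded_cst.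
rewrite {1}/moment4 -(@cexpect_mulmx _ _ _ P_haar _ (rotation_mx p q c s)) //;
  last exact: unitary_rotation_mx.
(* The sixteen terms of the expansion, grouped into nine by commutativity. The first three have
   matching indices; the other six vanish by [moment4_eq0]. *)
transitivity (cexpect P (fun x => \sum_(t <- [::
    (c ^+ 4, (p, p, p, p)); (s ^+ 4, (q, q, q, q));
    (4 * c ^+ 2 * s ^+ 2, (p, q, p, q));
    (2 * c ^+ 3 * s, (p, p, p, q)); (2 * c ^+ 3 * s, (p, q, p, p));
    (2 * c * s ^+ 3, (q, q, p, q)); (2 * c * s ^+ 3, (p, q, q, q));
    (c ^+ 2 * s ^+ 2, (p, p, q, q)); (c ^+ 2 * s ^+ 2, (q, q, p, p))])
    t.1 * monom4 t.2.1.1.1 t.2.1.1.2 t.2.1.2 t.2.2 x)).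
  congr cexpect; apply/funext => x.
  rewrite /monom4 !rotation_mxE // !big_cons big_nil /=.
  by rewrite !rmorphD !rmorphM /= cJ sJ; ring.
rewrite (cexpect_sum P_haar) // !big_cons big_nil /= !(cexpectZ P_haar) //.
rewrite -!/(moment4 _ _ _ _).
rewrite (@moment4_eq0 q p p p q) ?(@moment4_eq0 q p q p p) ?(@moment4_eq0 p q q p q)
  ?(@moment4_eq0 p p q q q) ?(@moment4_eq0 p p p q q) ?(@moment4_eq0 p q q p p);
  rewrite ?eqxx ?(negPf pq) ?(negPf qp) //.
by ring.
Qed.

Lemma moment4_diag p q : moment4 p p p p = moment4 q q q q.
Proof.
have [->//|pq] := eqVneq p q.
(* A quarter turn carries coordinate [q] to position [p]. *)
rewrite (@moment4_rotation p q 0 1 pq) ?rmorph0 ?rmorph1 ?expr0n ?expr1n ?add0r //=.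
by ring.
Qed.

Lemma moment4_offdiag p q : p != q -> moment4 p p p p = 2 * moment4 p q p q.
Proof.
move=> pq.
(* The 3-4-5 triangle gives a rational rotation with both entries nonzero, avoiding square roots. *)
have := @moment4_rotation p q (3 / 5) (4 / 5) pq.
rewrite -(moment4_diag p q) !rmorphM !fmorphV !rmorph_nat => /(_ erefl erefl).
have five : (5 : C) != 0 by rewrite pnatr_eq0.
have -> : (3 / 5) ^+ 2 + (4 / 5) ^+ 2 = 1 :> C by field.
move=> /(_ erefl) => E.
(* Here [288 / 625] equals [1 - (3 / 5) ^+ 4 - (4 / 5) ^+ 4], and also
   [2 * (3 / 5) ^+ 2 * (4 / 5) ^+ 2]. *)
have : (288 / 625 : C) * (moment4 p p p p - 2 * moment4 p q p q) = 0.
  have six : (625 : C) != 0 by rewrite pnatr_eq0.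
  rewrite mulrBr [X in X - _](_ : _ = moment4 p p p p -
    ((3 / 5) ^+ 4 * moment4 p p p p + (4 / 5) ^+ 4 * moment4 p p p p)).
    by rewrite {1}E; field; rewrite ?six ?five.
  by field; rewrite ?six ?five.
by move/eqP; rewrite mulf_eq0 mulf_eq0 invr_eq0 !pnatr_eq0 /= subr_eq0 => /eqP.
Qed.

(** The summed monomials are the square of [dotc x x], which is 1 on the sphere; this normalises the
    moments. *)
Lemma moment4_total : \sum_p \sum_q moment4 p q p q = 1.
Proof.
have bM := sphere_bounded_monom4.
rewrite -[RHS](@eq_cexpect_sphere _ _ _ P_haar
  (fun x => \sum_p \sum_q monom4 p q p q x)).
- rewrite (cexpect_sum P_haar); last by move=> p; exact: sphere_bounded_sum.
  by apply: eq_bigr => p _; rewrite (cexpect_sum P_haar).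
- have [//] : sphere_bounded (fun x => \sum_p \sum_q monom4 p q p q x).
  by do 2!apply: sphere_bounded_sum => ?.
- move=> x; rewrite /unit_sphere /= => x1.
  transitivity (dotc (x : 'cV[C]_d) x * dotc (x : 'cV[C]_d) x); last by rewrite x1 mulr1.
  rewrite /dotc mulr_suml; apply: eq_bigr => p _; rewrite mulr_sumr.
  by apply: eq_bigr => q _; rewrite /monom4; ring.
Qed.

Lemma moment4E l m l' m' :
  moment4 l m l' m' = (d%:R * (d%:R + 1))^-1 *
    (((l == l') && (m == m'))%:R + ((l == m') && (m == l'))%:R).
Proof.
set b := (_)^-1.
have dn0 : d%:R * (d%:R + 1) != 0 :> C.
  by rewrite mulf_neq0 ?natr1 ?pnatr_eq0 // -lt0n; exact: leq_ltn_trans (ltn_ord l).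
(* All paired moments are expressed through one unknown, half of [moment4 l l l l]. *)
have pairE p q : moment4 p q p q = moment4 l l l l / 2 * (1 + (p == q)%:R).
  have two : (2 : C) != 0 by rewrite pnatr_eq0.
  have [<-|pq] := eqVneq p q; first by rewrite (moment4_diag p l) /=; field.
  by rewrite (moment4_diag l p) (moment4_offdiag pq) /=; field.
have diagE : moment4 l l l l / 2 = b.
  (* The unknown is fixed by the total: [1 + (p == q)%:R] summed over all pairs is [d * (d + 1)]. *)
  apply: (mulIf dn0); rewrite mulVf // -[RHS]moment4_total.
  under eq_bigr do under eq_bigr do rewrite pairE.
  under eq_bigr => p _.
    rewrite -mulr_sumr big_split /= sumr_const card_ord (bigD1 p) //= eqxx.
    rewrite big1 ?addr0; last by move=> q; rewrite eq_sym => /negPf ->.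
    over.
  by rewrite sumr_const card_ord -[RHS]mulr_natl /=; ring.
rewrite diagE in pairE.
have [<-|ll'] := eqVneq l l'; have [<-|mm'] := eqVneq m m' => /=.
- by rewrite pairE (eq_sym m) andbb.
- rewrite (@moment4_eq0 m) ?eqxx; last by rewrite (eq_sym m') (negPf mm') eqn_add2l.
  have [lm'|] := eqVneq l m'; last by rewrite addr0 mulr0.
  by rewrite lm' (negPf mm') addr0 mulr0.
- have -> : (l == m) && (m == l') = false.
    by apply/negbTE; apply: contra ll' => /andP[/eqP -> /eqP ->].
  by rewrite addr0 mulr0 (@moment4_eq0 l) // eqxx (eq_sym l') (negPf ll') eqn_add2r.
- have [lm'|lm'] := eqVneq l m'; last first.
    rewrite addr0 mulr0 (@moment4_eq0 l) // eqxx (eq_sym l') (negPf ll').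
    by rewrite (eq_sym m') (negPf lm') addn0.
  have [ml'|ml'] := eqVneq m l' => /=.
    rewrite -lm' -ml' in ll' *.
    (* The crossed pairing is the straight one after commuting the two conjugated factors. *)
    have -> : b * (0%:R + 1%:R) = moment4 l m l m.
      by rewrite pairE (negPf ll') addrC.
    by rewrite /moment4; congr cexpect; apply/funext => x; rewrite /monom4; ring.
  rewrite addr0 mulr0 (@moment4_eq0 m) // eqxx (eq_sym l') (negPf ml') lm'.
  by rewrite (eq_sym m') (negPf mm').
Qed.

End HaarMoments.

(** * Sums of Kronecker deltas *)

Section Sums.
Variable C : comNzRingType.

Lemma sum_pairE (I J : finType) (F : I * J -> C) :
  \sum_p F p = \sum_i \sum_j F (i, j).
Proof. by rewrite pair_bigA; apply: eq_bigr => -[]. Qed.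

Lemma sum_delta (I : finType) (F : I -> C) i0 :
  \sum_i (i == i0)%:R * F i = F i0.
Proof.
rewrite (bigD1 i0) //= eqxx mul1r big1 ?addr0 // => i /negPf ->.
by rewrite mul0r.
Qed.

Lemma sum_delta_inj (I : finType) (h : I -> I) (u v : I) : injective h ->
  \sum_i (u == h i)%:R * (v == h i)%:R = (u == v)%:R :> C.
Proof.
move=> h_inj; transitivity (\sum_i (i == u)%:R * (v == i)%:R : C).
  rewrite [RHS](reindex_inj h_inj); apply: eq_bigr => i _.
  by rewrite (eq_sym u).
by rewrite sum_delta eq_sym.
Qed.

End Sums.

(** * Permutation tensors as Latin squares *)

Lemma sum_nat_eq1_delta (I : finType) (F : I -> nat) :
  (\sum_i F i = 1)%N -> exists i0, forall i, F i = (i == i0).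
Proof.
move=> F1; have [i0 Fi0|F0] := pickP (fun i => 0 < F i)%N; last first.
  by move: F1; rewrite big1 // => i _; move: (F0 i); rewrite lt0n => /eqP.
exists i0; move: F1 Fi0; rewrite (bigD1 i0) //=.
case Fn: (F i0) => [//|n]; rewrite addSn => -[] /eqP + _.
rewrite addn_eq0 sum_nat_eq0 => /andP[/eqP n0 /forallP F0] i.
case: eqVneq => [->|ii0]; first by rewrite Fn n0.
by have := F0 i; rewrite ii0 => /eqP.
Qed.

(** The sums over [j] define [pi]; those over [l] make its rows injective, and those over [k] its
    columns. *)
Lemma latin_of_tensor (d : nat) (A : 'I_d -> 'I_d -> 'I_d -> nat) :
  tristochastic_perm_tensor A ->
  exists pi : 'I_d -> 'I_d -> 'I_d,
    [/\ forall k l j, A k l j = (j == pi k l),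
        forall k, injective (pi k) & forall l, injective (pi^~ l)].
Proof.
move=> [_ A1 A2 A3].
have /choice[pi piE] : forall kl : 'I_d * 'I_d, exists j0,
    forall j, A kl.1 kl.2 j = (j == j0).
  by move=> kl; exact: sum_nat_eq1_delta (A3 _ _).
exists (fun k l => pi (k, l)); split.
- by move=> k l j; exact: (piE (k, l)).
- move=> k l l' ll'; have [l0 E] := sum_nat_eq1_delta (A2 k (pi (k, l))).
  have := E l; rewrite (piE (k, l)) eqxx => /esym/eqP; rewrite eqb1 => /eqP ->.
  have := E l'; rewrite (piE (k, l')) -ll' eqxx => /esym/eqP.
  by rewrite eqb1 => /eqP ->.
- move=> l k k' kk'; have [k0 E] := sum_nat_eq1_delta (A1 l (pi (k, l))).
  have := E k; rewrite (piE (k, l)) eqxx => /esym/eqP; rewrite eqb1 => /eqP ->.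
  have := E k'; rewrite (piE (k', l)) -[pi (k', l)]kk' eqxx => /esym/eqP.
  by rewrite eqb1 => /eqP ->.
Qed.

(** * Complete positivity and trace preservation of kernels *)

Section Channels.
Variable R : realType.
Local Notation C := R[i].

(** The quadratic form of the output at [v] is the sum over [s] of the quadratic form of [X] at
    [w s], the image of [v] under the adjoint of the Kraus operator [V s] acting on the second
    factor. *)
Lemma completely_positive_kraus (I J S : finType) (V : S -> J -> I -> C) :
  completely_positive (fun j j' i i' => \sum_s V s j i * (V s j' i')^*).
Proof.
move=> n X X_psd v.
pose w s (p : 'I_n * I) := \sum_j (V s j p.2)^* * v (p.1, j).
suff -> : \sum_p \sum_q (v p)^* *
    (\sum_i \sum_i' (\sum_s V s p.2 i * (V s q.2 i')^*) *
      X (p.1, i) (q.1, i')) * v q =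
    \sum_s \sum_p \sum_q (w s p)^* * X p q * w s q.
  by apply: sumr_ge0 => s _; exact: X_psd.
pose F s a i j b i' j' := V s j i * (v (a, j))^* * X (a, i) (b, i') *
  ((V s j' i')^* * v (b, j')).
transitivity (\sum_s \sum_a \sum_b \sum_i \sum_i' \sum_j \sum_j' F s a i j b i' j').
  rewrite [RHS]exchange_big sum_pairE; apply: eq_bigr => a _ /=.
  rewrite [RHS]exchange_big /=.
  under eq_bigr do rewrite sum_pairE.
  rewrite exchange_big; apply: eq_bigr => b _ /=.
  under [RHS]eq_bigr => s _.
    under eq_bigr => i _.
      rewrite exchange_big; under eq_bigr do rewrite exchange_big.
      over.
    rewrite exchange_big; under eq_bigr do rewrite exchange_big.
    over.
  rewrite [RHS]exchange_big; apply: eq_bigr => j _ /=.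
  rewrite [RHS]exchange_big; apply: eq_bigr => j' _ /=.
  rewrite [RHS]exchange_big mulr_sumr mulr_suml; apply: eq_bigr => i _ /=.
  rewrite [RHS]exchange_big mulr_sumr mulr_suml; apply: eq_bigr => i' _ /=.
  rewrite mulr_suml mulr_sumr mulr_suml; apply: eq_bigr => s _.
  by rewrite /F; ring.
apply: eq_bigr => s _; rewrite sum_pairE; apply: eq_bigr => a _.
under [RHS]eq_bigr do rewrite sum_pairE.
rewrite [RHS]exchange_big; apply: eq_bigr => b _ /=.
apply: eq_bigr => i _; apply: eq_bigr => i' _.
rewrite /w rmorph_sum /= !mulr_suml; apply: eq_bigr => j _.
rewrite mulr_sumr; apply: eq_bigr => j' _.
by rewrite /F rmorphM /= conjCK.
Qed.

Lemma trace_preservingP (I J : finType) (K : J -> J -> I -> I -> C) :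
  trace_preserving K <-> forall i i', \sum_j K j j i i' = (i == i')%:R.
Proof.
have traceE X : \sum_j apply_kernel K X j j =
    \sum_i \sum_i' (\sum_j K j j i i') * X i i'.
  rewrite /apply_kernel exchange_big; apply: eq_bigr => i _ /=.
  by rewrite exchange_big; apply: eq_bigr => i' _ /=; rewrite mulr_suml.
split=> [tp i i'|KE X].
  (* Testing on a matrix unit isolates one entry of the kernel's partial trace. *)
  have := tp (fun a b => (a == i)%:R * (b == i')%:R); rewrite traceE.
  under eq_bigr do under eq_bigr do rewrite mulrCA [_ * (_ == i')%:R]mulrC.
  under eq_bigr do rewrite -mulr_sumr sum_delta.
  by rewrite !sum_delta.
rewrite traceE; apply: eq_bigr => i _.
by under eq_bigr do rewrite KE eq_sym; rewrite sum_delta.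
Qed.

End Channels.

(** * Completeness of orthonormal bases and Parseval's identity *)

Lemma orthonormal_basis_complete (R : realType) (d : nat)
    (b : 'I_d -> 'cV[R[i]]_d) (i j : 'I_d) :
  orthonormal_basis b -> \sum_l b l i 0 * (b l j 0)^* = (i == j)%:R.
Proof.
move=> ob; pose M := \matrix_(i, l) b l i 0; pose N := \matrix_(l, i) (b l i 0)^*.
(* Orthonormality gives a one-sided inverse; for square matrices it is two-sided, which is
   completeness. *)
have /mulmx1C /matrixP /(_ i j) : N *m M = 1%:M.
  apply/matrixP => l l'; rewrite !mxE -[RHS]ob.
  by apply: eq_bigr => a _; rewrite !mxE.
by rewrite !mxE => <-; apply: eq_bigr => l _; rewrite !mxE.
Qed.

Lemma dotcC (R : realType) (d : nat) (u v : 'cV[R[i]]_d) :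
  dotc v u = (dotc u v)^*.
Proof.
by rewrite /dotc rmorph_sum; apply: eq_bigr => i _; rewrite rmorphM /= conjCK mulrC.
Qed.

Lemma parseval (R : realType) (d : nat) (b : 'I_d -> 'cV[R[i]]_d)
    (v : 'cV[R[i]]_d) :
  orthonormal_basis b -> \sum_l `|dotc (b l) v| ^+ 2 = dotc v v.
Proof.
move=> ob.
transitivity (\sum_l \sum_i \sum_j (v i 0)^* * v j 0 * (b l i 0 * (b l j 0)^*)).
  apply: eq_bigr => l _; rewrite normCKC -dotcC /dotc mulr_suml.
  apply: eq_bigr => i _; rewrite mulr_sumr; apply: eq_bigr => j _; ring.
rewrite exchange_big; apply: eq_bigr => i _ /=; rewrite exchange_big /=.
under eq_bigr => j _ do
  rewrite -mulr_sumr orthonormal_basis_complete // eq_sym mulrC.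
by rewrite sum_delta.
Qed.

(** * Trace preservation of the three maps in terms of overlaps *)

Section LatinUnitary.
Variables (R : realType) (d : nat).
Local Notation C := R[i].
Variables (A : 'I_d -> 'I_d -> 'I_d -> nat) (a : 'I_d -> 'I_d -> 'cV[C]_d).
Variable pi : 'I_d -> 'I_d -> 'I_d.
Hypothesis AE : forall k l j, A k l j = (j == pi k l).
Hypothesis pi_injr : forall k, injective (pi k).
Hypothesis pi_injl : forall l, injective (pi^~ l).
Hypothesis a_basis : forall k, orthonormal_basis (a k).
Implicit Types k l j m : 'I_d.

Local Notation G k l k' l' := (dotc (a k' l') (a k l)).

Lemma dyn_mx_U_of k l j k' l' j' :
  dyn_mx (U_of A a) k l j k' l' j' =
  (j == pi k l)%:R * (j' == pi k' l')%:R * G k l k' l'.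
Proof.
rewrite /dyn_mx /U_of /dotc mulr_sumr; apply: eq_bigr => i _.
by rewrite !AE rmorphM /= conjC_nat; ring.
Qed.

Definition same_l_orthogonal :=
  forall k k' l, k != k' -> G k l k' l = 0.

Definition same_j_orthogonal :=
  forall k k' l l', k != k' -> pi k l = pi k' l' -> G k l k' l' = 0.

(** For [l != l'] orthogonality inside each basis kills every term; for [l = l'] the column [pi^~ l]
    is a bijection, so the sum over [k] is a delta. *)
Lemma chan1_trace_preserving : trace_preserving (chan1_kernel (U_of A a)).
Proof.
apply/trace_preservingP => -[l j] [l' j']; rewrite /chan1_kernel /=.
under eq_bigr do rewrite dyn_mx_U_of a_basis.
have [<-|ll'] := eqVneq l l'; last first.
  by rewrite xpair_eqE (negPf ll') big1 // => k _; rewrite mulr0.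
rewrite xpair_eqE eqxx /=; under eq_bigr do rewrite mulr1.
exact: sum_delta_inj.
Qed.

Lemma chan2_trace_preservingP :
  trace_preserving (chan2_kernel (U_of A a)) <-> same_l_orthogonal.
Proof.
rewrite trace_preservingP /chan2_kernel; split=> [tp k k' l kk'|ortho].
  (* With these inputs, injectivity of the row [pi k] leaves only the term at [l], which is the
     overlap in question. *)
  have := tp (k, pi k l) (k', pi k' l); rewrite xpair_eqE (negPf kk') /=.
  under eq_bigr do rewrite dyn_mx_U_of (inj_eq (@pi_injr _)) eq_sym -mulrA.
  by rewrite sum_delta (inj_eq (@pi_injr _)) eqxx mul1r.
move=> [k j] [k' j'] /=; rewrite xpair_eqE.
under eq_bigr do rewrite dyn_mx_U_of.
have [<-|kk'] := eqVneq k k'; last first.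
  by rewrite big1 // => l _; rewrite ortho // mulr0.
under eq_bigr do rewrite a_basis eqxx mulr1.
exact: sum_delta_inj.
Qed.

Lemma chan3_trace_preservingP :
  trace_preserving (chan3_kernel (U_of A a)) <-> same_j_orthogonal.
Proof.
have sumE k l k' l' : \sum_j dyn_mx (U_of A a) k l j k' l' j =
    (pi k l == pi k' l')%:R * G k l k' l'.
  by under eq_bigr do rewrite dyn_mx_U_of -mulrA; rewrite sum_delta.
rewrite trace_preservingP /chan3_kernel; split=> [tp k k' l l' kk' E|ortho].
  have := tp (k, l) (k', l').
  by rewrite xpair_eqE (negPf kk') /= sumE E eqxx mul1r.
move=> [k l] [k' l'] /=; rewrite sumE xpair_eqE.
have [<-|kk'] := eqVneq k k'.
  rewrite (inj_eq (@pi_injr _)) a_basis eq_sym.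
  by case: eqP => /= _; rewrite ?mul1r ?mul0r.
by have [E|_] := eqVneq (pi k l) (pi k' l'); rewrite ?mul0r // ortho // mulr0.
Qed.

Lemma quantum_tristochasticP :
  quantum_tristochastic (U_of A a) <->
  same_l_orthogonal /\ same_j_orthogonal.
Proof.
(* In all three maps the traced output index [i] labels the Kraus operators; only the choice of
   output among [k], [l], [j] changes. *)
have cp1 := completely_positive_kraus (fun i k (p : 'I_d * 'I_d) => U_of A a k i p.1 p.2).
have cp2 := completely_positive_kraus (fun i l (p : 'I_d * 'I_d) => U_of A a p.1 i l p.2).
have cp3 := completely_positive_kraus (fun i j (p : 'I_d * 'I_d) => U_of A a p.1 i p.2 j).
split=> [[_ [_ tp2] [_ tp3]] | [hl hj]].
  by split; [apply/chan2_trace_preservingP|apply/chan3_trace_preservingP].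
split; split=> //.
- exact: chan1_trace_preserving.
- exact/chan2_trace_preservingP.
- exact/chan3_trace_preservingP.
Qed.

(** The quantity [Q] of the outline. It is kept complex: [0 <= Q] in [C] also says that it is
    real. *)
Definition overlap_defect : C := \sum_k \sum_(k' | k' != k)
  ((\sum_l `|G k l k' l| ^+ 2) +
   \sum_l \sum_l' (pi k l == pi k' l')%:R * `|G k l k' l'| ^+ 2).

Lemma overlap_defect_ge0 : 0 <= overlap_defect.
Proof.
do 2!apply: sumr_ge0 => ? _; apply: addr_ge0.
  by apply: sumr_ge0 => l _; rewrite exprn_ge0.
by do 2!apply: sumr_ge0 => ? _; rewrite mulr_ge0 ?exprn_ge0.
Qed.

Lemma overlap_defect_eq0 :
  overlap_defect = 0 <-> same_l_orthogonal /\ same_j_orthogonal.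
Proof.
have s1_ge0 k k' : 0 <= \sum_l `|G k l k' l| ^+ 2.
  by apply: sumr_ge0 => l _; rewrite exprn_ge0.
have s2_ge0 k k' l : 0 <= \sum_l' (pi k l == pi k' l')%:R * `|G k l k' l'| ^+ 2.
  by apply: sumr_ge0 => l' _; rewrite mulr_ge0 ?exprn_ge0.
split=> [Q0|[hl hj]].
  suff o k k' : k != k' -> \sum_l `|G k l k' l| ^+ 2 = 0 /\
      \sum_l \sum_l' (pi k l == pi k' l')%:R * `|G k l k' l'| ^+ 2 = 0.
    split=> [k k' l /o[+ _]|k k' l l' /o[_ +] E].
      move/psumr_eq0P => /(_ (fun _ _ => exprn_ge0 _ (normr_ge0 _)) l isT)/eqP.
      by rewrite expf_eq0 normr_eq0 => /eqP.
    move/psumr_eq0P => /(_ (fun l _ => s2_ge0 k k' l) l isT).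
    move/psumr_eq0P => /(_ (fun _ _ => mulr_ge0 (ler0n _ _) (exprn_ge0 _ (normr_ge0 _))) l' isT).
    by rewrite E eqxx mul1r => /eqP; rewrite expf_eq0 normr_eq0 => /eqP.
  move=> kk'.
  have term_ge0 k1 k2 : 0 <= (\sum_l `|G k1 l k2 l| ^+ 2) +
     \sum_l \sum_l' (pi k1 l == pi k2 l')%:R * `|G k1 l k2 l'| ^+ 2.
    by apply: addr_ge0 => //; apply: sumr_ge0.
  have := psumr_eq0P (fun k1 _ => sumr_ge0 _ (fun k2 _ => term_ge0 k1 k2)) Q0.
  move=> /(_ k isT) /(psumr_eq0P (fun k2 _ => term_ge0 k k2)).
  rewrite eq_sym in kk'; move=> /(_ k' kk') /eqP.
  by rewrite paddr_eq0 //; [move=> /andP[/eqP -> /eqP ->]|exact: sumr_ge0].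
rewrite /overlap_defect big1 // => k _; rewrite big1 // => k' k'k.
rewrite eq_sym in k'k.
rewrite !big1 ?addr0 // => l _; last by rewrite hl // normr0 expr0n.
rewrite big1 // => l' _; have [E|_] := eqVneq (pi k l) (pi k' l').
  by rewrite hj // normr0 expr0n mulr0.
by rewrite mul0r.
Qed.

(** * The mean purity as a sum over index sextuples *)

Local Notation idx6 := (('I_d * 'I_d) * (('I_d * 'I_d) * ('I_d * 'I_d)))%type.

(* The index is [((k, k'), ((l, l'), (m', m)))]. *)
Definition purity_coef (t : idx6) : C :=
  G t.1.1 t.2.1.1 t.1.2 t.2.1.2 * G t.1.2 t.2.2.1 t.1.1 t.2.2.2.

Definition purity_monomA (t : idx6) (x : state_space R d) : C :=
  monom4 t.2.1.1 t.2.2.1 t.2.1.2 t.2.2.2 x.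

Definition purity_monomB (t : idx6) (y : state_space R d) : C :=
  monom4 (pi t.1.1 t.2.1.1) (pi t.1.2 t.2.2.1)
         (pi t.1.2 t.2.1.2) (pi t.1.1 t.2.2.2) y.

Lemma red_dens_U_of (x y : 'cV[C]_d) k k' :
  red_dens (apply_U_prod (U_of A a) x y) k k' =
  \sum_(p : 'I_d * 'I_d) G k p.1 k' p.2 *
    (x p.1 0 * y (pi k p.1) 0 * (x p.2 0 * y (pi k' p.2) 0)^*).
Proof.
have applyE h i : apply_U_prod (U_of A a) x y h i =
    \sum_l a h l i 0 * (x l 0 * y (pi h l) 0).
  rewrite /apply_U_prod /U_of; apply: eq_bigr => l _.
  under eq_bigr do rewrite AE -mulrA.
  by rewrite sum_delta.
rewrite /red_dens sum_pairE.
under eq_bigr do rewrite !applyE rmorph_sum mulr_suml.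
rewrite exchange_big; apply: eq_bigr => l _ /=.
under eq_bigr do rewrite mulr_sumr.
rewrite exchange_big; apply: eq_bigr => l' _ /=.
rewrite /dotc mulr_suml; apply: eq_bigr => i _.
by rewrite rmorphM /=; ring.
Qed.

(** At output [k] the coordinate [l] of [x] meets only the coordinate [pi k l] of [y], so each term
    is a quartic monomial in [x] times one in [y], and the independent averages act separately. *)
Lemma purity_U_of (x y : state_space R d) :
  let phi := apply_U_prod (U_of A a) x y in
  \sum_k \sum_k' red_dens phi k k' * red_dens phi k' k =
  \sum_t purity_coef t * (purity_monomA t x * purity_monomB t y).
Proof.
move=> phi; rewrite [RHS]sum_pairE [RHS]sum_pairE.
apply: eq_bigr => k _; apply: eq_bigr => k' _.
rewrite /phi !red_dens_U_of mulr_suml [RHS]sum_pairE; apply: eq_bigr => -[l l'] _.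
rewrite mulr_sumr; apply: eq_bigr => -[m' m] _ /=.
rewrite /purity_coef /purity_monomA /purity_monomB /monom4 /= !rmorphM /=.
by ring.
Qed.

(* The four products of Kronecker deltas in [E x^4 * E y^4]: the mixed ones
   give the two families of overlaps, and the product of the two first ones
   survives only for [k = k'] because [pi] is a Latin square. *)
Lemma sum_purity_delta :
  \sum_(t : idx6) purity_coef t *
    ((((t.2.1.1 == t.2.1.2) && (t.2.2.1 == t.2.2.2))%:R +
      ((t.2.1.1 == t.2.2.2) && (t.2.2.1 == t.2.1.2))%:R) *
     (((pi t.1.1 t.2.1.1 == pi t.1.2 t.2.1.2) &&
       (pi t.1.2 t.2.2.1 == pi t.1.1 t.2.2.2))%:R +
      ((pi t.1.1 t.2.1.1 == pi t.1.1 t.2.2.2) &&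
       (pi t.1.2 t.2.2.1 == pi t.1.2 t.2.1.2))%:R)) =
  2 * d%:R ^+ 2 * (d%:R + 1) + overlap_defect.
Proof.
pose s1 k k' := \sum_l `|G k l k' l| ^+ 2 : C.
pose s2 k k' := \sum_l \sum_l' (pi k l == pi k' l')%:R * `|G k l k' l'| ^+ 2 : C.
have blockE k k' :
    \sum_(u : ('I_d * 'I_d) * ('I_d * 'I_d)) purity_coef ((k, k'), u) *
    ((((u.1.1 == u.1.2) && (u.2.1 == u.2.2))%:R +
      ((u.1.1 == u.2.2) && (u.2.1 == u.1.2))%:R) *
     (((pi k u.1.1 == pi k' u.1.2) && (pi k' u.2.1 == pi k u.2.2))%:R +
      ((pi k u.1.1 == pi k u.2.2) && (pi k' u.2.1 == pi k' u.1.2))%:R)) =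
    (k == k')%:R * d%:R ^+ 2 + d%:R + s1 k k' + s2 k k'.
  have GG k1 l1 k2 l2 : G k1 l1 k2 l2 * G k2 l2 k1 l1 = `|G k1 l1 k2 l2| ^+ 2.
    by rewrite normCK -dotcC.
  (* The products of the pairings for [x] and [y], in order: straight-straight, crossed-crossed,
     straight-crossed, crossed-straight. Repeated deltas merge by idempotence. *)
  transitivity (
    \sum_l \sum_l' \sum_m' \sum_m
      (l' == l)%:R * ((m == m')%:R * ((pi k l == pi k' l')%:R *
        (pi k' m' == pi k m)%:R * (G k l k' l' * G k' m' k m))) +
    \sum_l \sum_l' \sum_m' \sum_m
      (m == l)%:R * ((m' == l')%:R * (G k l k' l' * G k' m' k m)) +
    \sum_l \sum_l' \sum_m' \sum_m
      (m == l)%:R * ((m' == l')%:R * ((l' == l)%:R * (m == m')%:R * (G k l k' l' * G k' m' k m))) +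
    \sum_l \sum_l' \sum_m' \sum_m
      (m == l)%:R * ((m' == l')%:R * ((pi k l == pi k' l')%:R *
        (pi k' m' == pi k m)%:R * (G k l k' l' * G k' m' k m)))).
    rewrite sum_pairE sum_pairE -!big_split; apply: eq_bigr => l _ /=.
    rewrite -!big_split; apply: eq_bigr => l' _ /=.
    rewrite sum_pairE -!big_split; apply: eq_bigr => m' _ /=.
    rewrite -!big_split; apply: eq_bigr => m _ /=.
    rewrite /purity_coef /= !(inj_eq (@pi_injr _)).
    rewrite (eq_sym l l') (eq_sym l m) (eq_sym m' m) -!mulnb !natrM.
    have sq (b : bool) : b%:R * b%:R = b%:R :> C by rewrite -natrM mulnb andbb.
    move: (sq (m == l)) (sq (m' == l')).
    by move: ((m == l)%:R) ((m' == l')%:R) => e1 e2 H1 H2; ring: H1 H2.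
  have sum1 : \sum_l \sum_l' \sum_m' \sum_m
      (l' == l)%:R * ((m == m')%:R * ((pi k l == pi k' l')%:R *
        (pi k' m' == pi k m)%:R * (G k l k' l' * G k' m' k m))) =
      (k == k')%:R * d%:R ^+ 2.
    transitivity (\sum_(l < d) \sum_(m < d) ((k == k')%:R : C)).
      apply: eq_bigr => l _; under eq_bigr do under eq_bigr do rewrite -mulr_sumr sum_delta.
      under eq_bigr do rewrite -mulr_sumr; rewrite sum_delta; apply: eq_bigr => m _.
      have [<-|kk'] := eqVneq k k'; first by rewrite !eqxx !a_basis !eqxx !mulr1.
      by rewrite (inj_eq (@pi_injl _)) (negPf kk') !mul0r.
    by rewrite !sumr_const !card_ord -mulrnA -[LHS]mulr_natl natrM; ring.
  have sum2 : \sum_l \sum_l' \sum_m' \sum_m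
      (m == l)%:R * ((m' == l')%:R * (G k l k' l' * G k' m' k m)) = d%:R.
    (* For fixed [l], the sum over [l'] is Parseval for the unit vector [a k l] in the basis
       [a k']. *)
    transitivity (\sum_(l < d) (1 : C)); last by rewrite sumr_const card_ord.
    apply: eq_bigr => l _.
    under eq_bigr do under eq_bigr do rewrite sum_delta.
    under eq_bigr do rewrite sum_delta GG.
    by rewrite parseval // a_basis eqxx.
  have sum3 : \sum_l \sum_l' \sum_m' \sum_m
      (m == l)%:R * ((m' == l')%:R * ((l' == l)%:R * (m == m')%:R *
        (G k l k' l' * G k' m' k m))) = s1 k k'.
    apply: eq_bigr => l _.
    under eq_bigr do under eq_bigr do rewrite sum_delta.
    under eq_bigr do rewrite sum_delta GG -mulrA.
    by rewrite sum_delta eqxx mul1r.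
  have sum4 : \sum_l \sum_l' \sum_m' \sum_m
      (m == l)%:R * ((m' == l')%:R * ((pi k l == pi k' l')%:R *
        (pi k' m' == pi k m)%:R * (G k l k' l' * G k' m' k m))) = s2 k k'.
    apply: eq_bigr => l _.
    under eq_bigr do under eq_bigr do rewrite sum_delta.
    under eq_bigr do rewrite sum_delta GG (eq_sym (pi k' _)) -natrM mulnb andbb.
    by [].
  by rewrite sum1 sum2 sum3 sum4.
rewrite sum_pairE sum_pairE.
under eq_bigr do under eq_bigr do rewrite blockE.
(* For fixed [k], the straight-straight term gives [d^2], the Parseval terms over all [k'] give
   [d^2], and [s1 k k] and [s2 k k] give [d] each. *)
transitivity (\sum_k (d%:R * (2 * d%:R + 2) +
    \sum_(k' | k' != k) (s1 k k' + s2 k k'))); last first.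
  by rewrite big_split /= sumr_const card_ord -[X in X + _ = _]mulr_natl; congr (_ + _); ring.
apply: eq_bigr => k _.
under eq_bigr do rewrite -addrA -addrA.
rewrite big_split /= big_split /= sumr_const card_ord.
under eq_bigr do rewrite eq_sym; rewrite sum_delta (bigD1 k) //=.
have -> : s1 k k = d%:R.
  rewrite /s1; under eq_bigr do rewrite a_basis eqxx normr1 expr1n.
  by rewrite sumr_const card_ord.
have -> : s2 k k = d%:R.
  rewrite /s2; under eq_bigr => l _.
    under eq_bigr do rewrite (inj_eq (@pi_injr _)) eq_sym.
    rewrite sum_delta a_basis eqxx normr1 expr1n; over.
  by rewrite sumr_const card_ord.
by rewrite -[d%:R *+ d]mulr_natl; ring.
Qed.

(** * Haar average of the linear entropy and the entangling power *)

Variable P : probability (state_space R d) R.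
Hypothesis P_haar : haar_pure_state_measure P.

Lemma mean_linear_entropy :
  Rintegral P setT (fun x : state_space R d =>
    Rintegral P setT (fun y : state_space R d =>
      linear_entropy (apply_U_prod (U_of A a) x y))) =
  complex.Re (1 - (d%:R * (d%:R + 1)) ^- 2 *
    (2 * d%:R ^+ 2 * (d%:R + 1) + overlap_defect)).
Proof.
have bA t : sphere_bounded (purity_monomA t) by exact: sphere_bounded_monom4.
have bB t : sphere_bounded (purity_monomB t) by exact: sphere_bounded_monom4.
have bZ (c : C) f : sphere_bounded f -> sphere_bounded (fun x : state_space R d => c * f x).
  by move=> bf; apply: sphere_boundedM => //; exact: sphere_bounded_cst.
(* Applied first to the inner integral, with [x] frozen in the coefficients, then to the outer one,
   with the moments of [y] as coefficients. *)
have expect_affine (c : idx6 -> C) (f : idx6 -> state_space R d -> C) :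
    (forall t, sphere_bounded (f t)) ->
    Rintegral P setT (fun x => complex.Re (1 - \sum_t c t * f t x)) =
    complex.Re (1 - \sum_t c t * cexpect P (f t)).
  move=> bf; have bcf t := bZ (c t) _ (bf t).
  transitivity (complex.Re (cexpect P (fun x => 1 + -1 * \sum_t c t * f t x))).
    by congr Rintegral; apply/funext => x; rewrite mulN1r.
  rewrite (cexpectD P_haar) ?cexpect_cst.
  - rewrite (cexpectZ P_haar) ?mulN1r; last exact: sphere_bounded_sum.
    rewrite (cexpect_sum P_haar) //; congr (complex.Re (_ - _)).
    by apply: eq_bigr => t _; rewrite (cexpectZ P_haar).
  - exact: sphere_bounded_cst.
  - by apply: bZ; exact: sphere_bounded_sum.
transitivity (Rintegral P setT (fun x : state_space R d =>
    complex.Re (1 - \sum_t purity_coef t * cexpect P (purity_monomB t) *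
      purity_monomA t x))).
  apply: eq_Rintegral => x _.
  transitivity (Rintegral P setT (fun y : state_space R d =>
      complex.Re (1 - \sum_t (purity_coef t * purity_monomA t x) *
        purity_monomB t y))).
    apply: eq_Rintegral => y _; rewrite /linear_entropy purity_U_of.
    by congr (complex.Re (_ - _)); apply: eq_bigr => t _; rewrite mulrA.
  rewrite expect_affine //; congr (complex.Re (_ - _)).
  by apply: eq_bigr => t _; rewrite mulrAC.
rewrite expect_affine // -sum_purity_delta; congr (complex.Re (_ - _)).
rewrite mulr_sumr; apply: eq_bigr => t _.
rewrite [cexpect P (purity_monomA t)](moment4E P_haar).
rewrite [cexpect P (purity_monomB t)](moment4E P_haar).
by rewrite -exprVn; ring.
Qed.

Lemma entangling_power_U_of : (2 <= d)%N ->
  entangling_power P (U_of A a) = 1 <-> overlap_defect = 0.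
Proof.
move=> hd; rewrite /entangling_power mean_linear_entropy.
have d0 : d%:R != 0 :> C by rewrite pnatr_eq0 -lt0n ltnW.
have d1 : d%:R + 1 != 0 :> C by rewrite natr1 pnatr_eq0.
have dB1 : 0 < d%:R - 1 :> C by rewrite subr_gt0 ltr1n.
have dB1' : d%:R - 1 != 0 :> C by rewrite gt_eqF.
(* This is [(d + 1) / (d - 1)] divided by [(d * (d + 1)) ^+ 2]. With zero defect the mean entropy is
   [1 - 2 / (d + 1)], which the prefactor turns into exactly 1. *)
pose c : C := ((d%:R - 1) * d%:R ^+ 2 * (d%:R + 1))^-1.
have c_gt0 : 0 < c.
  by rewrite invr_gt0 !mulr_gt0 ?exprn_gt0 ?ltr0n ?natr1 ?ltr0n // ltnW.
have -> : (d%:R + 1) / (d%:R - 1) * complex.Re (1 - (d%:R * (d%:R + 1)) ^- 2 *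
    (2 * d%:R ^+ 2 * (d%:R + 1) + overlap_defect)) =
    complex.Re (1 - c * overlap_defect).
  have -> : 1 - c * overlap_defect = (((d%:R + 1) / (d%:R - 1) : R)%:C)%C *
      (1 - (d%:R * (d%:R + 1)) ^- 2 *
      (2 * d%:R ^+ 2 * (d%:R + 1) + overlap_defect)).
    rewrite rmorphM fmorphV rmorphB rmorphD rmorph1 rmorph_nat /c.
    by field; rewrite d0 d1 dB1'.
  by rewrite complexReM /= mul0r subr0.
have cQ : 0 <= c * overlap_defect by rewrite mulr_ge0 ?overlap_defect_ge0 ?(ltW c_gt0).
have -> : complex.Re (1 - c * overlap_defect) = 1 - complex.Re (c * overlap_defect).
  by case: (c * overlap_defect).
split=> [E|->]; last by rewrite mulr0 subr0.
have re0 : complex.Re (c * overlap_defect) = 0 by lra.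
have /eqP : c * overlap_defect = 0.
  (* The real part vanishes by [re0]; the imaginary part vanishes because the order on [C] compares
     only numbers with equal imaginary parts. *)
  apply: complex_ext => //; by move: cQ; rewrite lecE => /andP[/eqP ->].
by rewrite mulf_eq0 gt_eqF //= => /eqP.
Qed.

End LatinUnitary.

Theorem theorem2 (R : realType) (d : nat) (hd : (2 <= d)%N)
  (A : 'I_d -> 'I_d -> 'I_d -> nat) (a : 'I_d -> 'I_d -> 'cV[R[i]]_d)
  (P : probability (state_space R d) R) :
  tristochastic_perm_tensor A ->
  (forall k : 'I_d, orthonormal_basis (a k)) ->
  haar_pure_state_measure P ->
  (entangling_power P (U_of A a) = 1 <-> quantum_tristochastic (U_of A a)).
Proof.
move=> /latin_of_tensor[pi [AE pi_injr pi_injl]] a_basis P_haar.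
apply: iff_trans; first exact: (entangling_power_U_of AE _ _ _ P_haar).
apply: iff_trans; first exact: overlap_defect_eq0.
by apply: iff_sym; exact: (quantum_tristochasticP AE).
Qed.
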